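(* Assume the setting described in the context and fix $T_1>0$. Suppose Assumptions (A1), (A2) and (A3) hold. Then \[\lim_{n\rightarrow\infty}\sup_{x\in F}\sup_{t\geq T_1}\left|\beta(n)q^n_{\lfloor\gamma(n)t\rfloor}(g_n(x))-q_t(x)\right|=0.\]
   Context: Let $(E,d_E)$ be a metric space and $F\subseteq E$ such that $F\cap\overline{B}_E(x,r)$ is compact for all $x\in E$, $r>0$; here $\overline{B}_E(x,r)$, $B_E(x,r)$ are the closed and open balls of $(E,d_E)$. Let $d_F:=d_E|_{F\times F}$ and let $B_F(x,r)$ be the open ball in $(F,d_F)$. Fix $\rho\in F$, a Radon measure $\nu$ of full support on $(F,d_F)$ (regarded also as a Borel measure on $E$ via $\nu(A):=\nu(A\cap F)$), and a function $(q_t(x))_{x\in F,t>0}$, jointly continuous in $(t,x)$, with $q_t\ge0$ and $\int_F q_t\,d\nu=1$ for each $t>0$. For a locally finite connected graph $G$ with at least two vertices, vertex set $V(G)$, edge set $E(G)$ and distinguished vertex $\rho(G)$: $d_G$ is the shortest-path metric and $B_G(x,r)$ the open $d_G$-ball; $\mu^G$ is a symmetric weight with $\mu^G_{xy}>0$ iff $\{x,y\}\in E(G)$; $\mu^G_x:=\sum_y\mu^G_{xy}$; $\nu^G(A):=\sum_{x\in A}\mu^G_x$. The discrete time simple random walk $X^G$ has transition probabilities $P_G(x,y)=\mu^G_{xy}/\mu^G_x$ and law $\mathbf{P}^G_x$ from $x$. Set $p^G_m(x,y):=\mathbf{P}^G_x(X^G_m=y)/\nu^G(\{y\})$, $q^G_m(x,y):=\frac12(p^G_m(x,y)+p^G_{m+1}(x,y))$,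 $q^G_m(x):=q^G_m(\rho(G),x)$. Let $(G^n)_{n\ge1}$ be locally finite connected graphs with $\#V(G^n)\ge2$, $V(G^n)\subseteq E$, $\rho(G^n)=\rho$; write $\nu^n,X^n,q^n,\mathbf{P}^{G^n}$ for $\nu^{G^n},X^{G^n},q^{G^n}$, etc. Let $(\alpha(n)),(\beta(n)),(\gamma(n))$ be non-negative sequences diverging to $\infty$. For $x\in E$, $g_n(x)$ denotes a point of $V(G^n)$ minimising $d_E(x,\cdot)$ over $V(G^n)$. Assumption (A1): (a) there is $c_1>0$ with $d_{G^n}(x,y)\ge c_1\alpha(n)d_E(x,y)$ for all $x,y\in V(G^n)$, $n\ge1$; and there is a non-negative sequence $\tilde\alpha(n)=o(\alpha(n))$ such that for each $r>0$ there exist $c_2<\infty$, $n_0$ with $d_{G^n}(x,y)\le c_2\alpha(n)d_E(x,y)+\tilde\alpha(n)$ for all $x,y\in V(G^n)\cap B_E(\rho,r)$, $n\ge n_0$. (b) For each $r>0$, $\lim_n\sup_{x\in B_F(\rho,r)}d_E(x,V(G^n))=0$. (c) For every $x\in F$, $r>0$, $\lim_n\beta(n)^{-1}\nu^n(B_E(x,r))=\nu(B_E(x,r))$. (d) For every compact interval $I\subset(0,\infty)$, $x\in F$, $r>0$, $\lim_n\mathbf{P}^{G^n}_\rho(X^n_{\lfloor\gamma(n)t\rfloor}\in B_E(x,r))=\int_{B_F(x,r)}q_t(y)\nu(dy)$ uniformly for $t\in I$. Assumption (A2): for every compact interval $I\subset(0,\infty)$ and $r>0$, \[\lim_{\delta\to0}\limsup_{n\to\infty}\sup_{\substack{x,y\in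 B_{G^n}(\rho,\alpha(n)r):\\ d_{G^n}(x,y)\le\alpha(n)\delta}}\sup_{t\in I}\beta(n)\left|q^n_{\lfloor\gamma(n)t\rfloor}(x)-q^n_{\lfloor\gamma(n)t\rfloor}(y)\right|=0.\] Assumption (A3): $(F,d_F)$ has the midpoint property (for all $x,y\in F$ there is $z\in F$ with $d_F(x,z)=\frac12 d_F(x,y)=d_F(z,y)$), and (a) $\lim_{t\to\infty}\sup_{x\in F}q_t(x)=0$ and $\lim_{r\to\infty}\sup_{x\in F\setminus B_F(\rho,r)}\sup_{t\in I}q_t(x)=0$ for every compact interval $I\subset(0,\infty)$; (b) $\lim_{t\to\infty}\limsup_{n\to\infty}\sup_{x\in V(G^n)}\beta(n)q^n_{\lfloor\gamma(n)t\rfloor}(x)=0$ and, for every compact interval $I\subset(0,\infty)$, $\lim_{r\to\infty}\limsup_{n\to\infty}\sup_{x\in V(G^n)\setminus B_{G^n}(\rho,\alpha(n)r)}\sup_{t\in I}\beta(n)q^n_{\lfloor\gamma(n)t\rfloor}(x)=0$. *)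

(* Defs.v *)
From HB Require Import structures.
From mathcomp Require Import all_boot all_order all_algebra.
From mathcomp Require Import all_classical all_reals all_analysis.
Set Implicit Arguments. Unset Strict Implicit. Unset Printing Implicit Defensive.
Import Order.TTheory GRing.Theory Num.Theory.
Import numFieldNormedType.Exports.
Local Open Scope classical_set_scope.
Local Open Scope ring_scope.

Section MetricDefs.
Variables (R : realType) (E : Type) (dE : E -> E -> R).

Definition is_metric : Prop :=
  [/\ forall x y, 0 <= dE x y,
      forall x y, dE x y = 0 <-> x = y,
      forall x y, dE x y = dE y x &
      forall x y z, dE x z <= dE x y + dE y z].

Definition dball (x : E) (r : R) : set E := [set y | dE x y < r].
Definition dcball (x : E) (r : R) : set E := [set y | dE x y <= r].

Definition dopen (A : set E) : Prop :=
  forall x, A x -> exists2 r : R, 0 < r & dball x r `<=` A.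

Definition dcompact (K : set E) : Prop :=
  forall (I : Type) (U : I -> set E), (forall i, dopen (U i)) ->
    K `<=` \bigcup_(i in [set: I]) U i ->
    exists J : set I, finite_set J /\ K `<=` \bigcup_(i in J) U i.

Definition dist_set (x : E) (A : set E) : R := inf [set dE x v | v in A].

End MetricDefs.

Section GraphDefs.
Variables (R : realType) (E : choiceType).
(* A weighted graph with vertex set V ⊆ E and symmetric weights mu:
   {x,y} is an edge iff mu x y > 0. *)
Variables (V : set E) (mu : E -> E -> R).

Definition adj (x y : E) : Prop := [/\ V x, V y & 0 < mu x y].

Inductive gpath : nat -> E -> E -> Prop :=
| gpath0 x : V x -> gpath 0 x x
| gpathS k x z y : adj x z -> gpath k z y -> gpath k.+1 x y.

Definition gdist (x y : E) : R := inf [set k%:R | k in [set k | gpath k x y]].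

Definition gball (x : E) (r : R) : set E := [set y | V y /\ gdist x y < r].

(* mu_x = sum_y mu_xy (finitely many nonzero terms by local finiteness) *)
Definition muv (x : E) : R := (\sum_(y \in V) mu x y)%R.

Definition nuG (A : set E) : \bar R := (\esum_(x in V `&` A) (muv x)%:E)%E.

Definition transP (x y : E) : R := mu x y / muv x.

Fixpoint stepP (m : nat) (x y : E) : R :=
  match m with
  | 0 => (asbool (x = y))%:R
  | m'.+1 => (\sum_(z \in V) transP x z * stepP m' z y)%R
  end.

Definition probIn (m : nat) (x : E) (A : set E) : R :=
  (\sum_(y \in V `&` A) stepP m x y)%R.

(* p^G_m(x,y) = P_x(X_m = y) / nu^G({y})  (nu^G({y}) = mu_y) *)
Definition pG (m : nat) (x y : E) : R := stepP m x y / muv y.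

Definition qG (m : nat) (x y : E) : R := (pG m x y + pG m.+1 x y) / 2.

Definition good_graph : Prop :=
  (exists x y, [/\ V x, V y & x <> y]) /\
  (forall x y, mu x y = mu y x) /\
  (forall x y, 0 <= mu x y) /\
  (forall x y, 0 < mu x y -> V x /\ V y) /\
  (forall x, mu x x = 0) /\
  (forall x, V x -> finite_set [set y | 0 < mu x y]) /\
  (forall x y, V x -> V y -> exists k, gpath k x y).

End GraphDefs.

Definition flr (R : realType) (x : R) : nat := Num.truncn x.

Section MeasDefs.
Local Open Scope ereal_scope.
Variables (R : realType) (d : measure_display) (E : measurableType d).
Variables (dE : E -> E -> R) (F : set E) (nu : {measure set E -> \bar R}).

Definition borel_of_metric : Prop := (@measurable d E) = <<s dopen dE >>.

Definition carried_by : Prop := forall A, measurable A -> nu A = nu (A `&` F).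

(* nu, restricted to F, is a Radon measure on (F, d_F): finite on compact
   sets, inner regular (by compacts) on open sets, outer regular (by open
   sets) on Borel sets.  Open sets of F are the sets U ∩ F, U open in E. *)
Definition radon_on : Prop :=
  (forall K, dcompact dE K -> K `<=` F -> nu K < +oo) /\
  (forall U, dopen dE U ->
     nu (U `&` F) = ereal_sup [set nu K | K in [set K | dcompact dE K /\ K `<=` U `&` F]]) /\
  (forall A, measurable A -> A `<=` F ->
     nu A = ereal_inf [set nu (U `&` F) | U in [set U | dopen dE U /\ A `<=` U]]).

Definition full_support_on : Prop :=
  forall U, dopen dE U -> U `&` F !=set0 -> 0 < nu (U `&` F).

End MeasDefs.

(* Main.v *)
Require Import Defs.
From HB Require Import structures.
From mathcomp Require Import all_boot all_order all_algebra.
From mathcomp Require Import all_classical all_reals all_analysis.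
From mathcomp Require Import measurable_realfun lra ring.
Set Implicit Arguments.
Unset Strict Implicit.
Unset Printing Implicit Defensive.
Import Order.TTheory GRing.Theory Num.Theory.
Import numFieldNormedType.Exports.
Local Open Scope classical_set_scope.
Local Open Scope ring_scope.

(** Fix a compact time interval and a point [x0] of [F]. On a small ball [B] around
    [x0], equicontinuity (A2) makes [beta n * q^n] nearly constant, so the averaged
    probability of hitting [B] is nearly [beta n * q^n(g_n x)] times
    [nu^n(B) / beta n]; by (A1) it also converges to the integral of [q_t] over [B],
    nearly [q_t(x) * nu(B)]. Dividing by [nu(B) > 0] gives a uniform estimate near
    [x0], and compactness extends it to bounded regions. Far from [rho] both sides
    are small by (A3), the midpoint property ensuring that [g_n x] is far whenever
    [x] is. For large times, reversibility shows that [sup_x q^n_m(x)] is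
    nonincreasing in [m], which makes the decay in (A3)(b) uniform in time. *)

(** * Finite sums and their comparison with extended sums *)

Lemma le_fsumr (R : realType) (T : choiceType) (S : set T) (f h : T -> R) :
  finite_set S -> (forall x, S x -> f x <= h x) ->
  \sum_(x \in S) f x <= \sum_(x \in S) h x.
Proof.
move=> fS fh; rewrite !fsbig_finite//= big_seq [leRHS]big_seq.
by apply: ler_sum => x; rewrite in_fset_set// inE => /fh.
Qed.

(** The right-hand sum equals the sum over [X] enlarged by the support of [f] in [S]. That support
    must be finite: a sum with infinite support is 0 by convention. *)
Lemma le_fsumr_subset (R : realType) (T : choiceType) (X S : set T) (f : T -> R) :
  finite_set X -> X `<=` S -> finite_set (S `&` f @^-1` [set~ 0]) ->
  (forall x, S x -> 0 <= f x) ->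
  \sum_(x \in X) f x <= \sum_(x \in S) f x.
Proof.
move=> fX XS fS f0; rewrite -(@fsbig_widen _ _ _ _ (X `|` (S `&` f @^-1` [set~ 0])) S) /=.
- rewrite [leRHS](fsbigID X) ?finite_setU//= (setIidr (@subsetUl _ X _)) lerDl fsumr_ge0//.
  by move=> x [[/XS|[]]]; auto.
- by move=> x [/XS|[]].
- by move=> x [Sx /not_orP[_]] /not_andP[]// /contrapT.
Qed.

(** The extended sum of [w] may a priori be infinite. If [lo > 0], every finite partial sum of [w]
    is at most [lo^-1] times the sum of [f]; if [lo <= 0], the lower bound is nonpositive. For the
    upper bound, only the finite support of [f] matters. *)
Lemma fsum_esum_bounds (R : realType) (T : choiceType) (S : set T)
    (f w : T -> R) (lo hi : R) :
  finite_set (S `&` f @^-1` [set~ 0]) ->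
  (forall x, S x -> 0 <= f x) -> (forall x, 0 <= w x) -> 0 <= hi ->
  (forall x, S x -> lo * w x <= f x <= hi * w x) ->
  (lo%:E * (\esum_(x in S) (w x)%:E) <= (\sum_(x \in S) f x)%:E
     <= hi%:E * (\esum_(x in S) (w x)%:E))%E.
Proof.
move=> fS f0 w0 hi0 fw; apply/andP; split.
- have [lo0|lo0] := leP lo 0.
    apply: (@le_trans _ _ 0%E); last by rewrite lee_fin fsumr_ge0.
    by apply: mule_le0_ge0; rewrite ?lee_fin// esum_ge0// => x _; rewrite lee_fin.
  rewrite -lee_pdivlMl//; apply: ge_ereal_sup => _ [X [fX XS] <-].
  rewrite fsumEFin// -EFinM lee_fin ler_pdivlMl// mulr_fsumr.
  apply: (le_trans _ (le_fsumr_subset fX XS fS f0)).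
  by apply: le_fsumr => // x /XS/fw/andP[].
- rewrite fsbig_supp; apply: (@le_trans _ _ (\sum_(x \in S `&` f @^-1` [set~ 0%R]) hi * w x)%R%:E).
    by rewrite lee_fin le_fsumr// => x [/fw/andP[]].
  rewrite -mulr_fsumr EFinM lee_wpmul2l ?lee_fin//.
  apply: esum_ge; exists (S `&` f @^-1` [set~ 0%R]).
    by split=> // x [].
  by rewrite fsumEFin.
Qed.

(** * Transition probabilities and heat kernels on a weighted graph *)

Section WeightedGraph.
Variables (R : realType) (E : choiceType) (V : set E) (mu : E -> E -> R).
Hypothesis gG : good_graph V mu.

Let nbr (x : E) : set E := [set y | 0 < mu x y].

Lemma mu_sym x y : mu x y = mu y x.
Proof. by case: gG => _ [+ _]; apply. Qed.

Lemma mu_ge0 x y : 0 <= mu x y.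
Proof. by case: gG => _ [_ [+ _]]; apply. Qed.

Lemma nbrV x : nbr x `<=` V.
Proof. by case: gG => _ [_ [_ [h _]]] y /h[]. Qed.

Lemma finite_nbr x : finite_set (nbr x).
Proof.
case: gG => _ [_ [_ [h [_ [fN _]]]]]; have [Vx|nVx] := pselect (V x).
  exact: fN.
by rewrite (_ : nbr x = set0)//; apply/seteqP; split=> // y /h[].
Qed.

Lemma mu_eq0 x y : ~ nbr x y -> mu x y = 0.
Proof. by move=> /negP; rewrite -leNgt => h; apply/le_anti; rewrite h mu_ge0. Qed.

Lemma muv_nbr x : muv V mu x = \sum_(y \in nbr x) mu x y.
Proof.
by apply/esym/fsbig_widen => [|y [_ /mu_eq0]//]; exact: nbrV.
Qed.

Lemma muv_ge0 x : 0 <= muv V mu x.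
Proof. by apply: fsumr_ge0 => y _; exact: mu_ge0. Qed.

(** A path from [x] to a different vertex starts with an edge of positive weight. *)
Lemma muv_gt0 x : V x -> 0 < muv V mu x.
Proof.
move=> Vx; have [y xy] : exists y, nbr x y.
  case: gG => -[u [v [Vu Vv uv]]] [_ [_ [_ [_ [_ conn]]]]].
  have [w [Vw xw]] : exists w, V w /\ x <> w.
    by have [->|] := pselect (x = u); [exists v|exists u].
  have [k p] := conn _ _ Vx Vw.
  by case: p xw => // {}k a z b [_ _ az] _ _; exists z.
rewrite muv_nbr (fsbigD1 y)//=; last exact: finite_nbr.
by rewrite ltr_pwDl// fsumr_ge0// => z _; exact: mu_ge0.
Qed.

Lemma transP_ge0 x y : 0 <= transP V mu x y.
Proof. by rewrite divr_ge0 ?mu_ge0 ?muv_ge0. Qed.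

Lemma transP_suml x (f : E -> R) :
  \sum_(z \in V) transP V mu x z * f z = \sum_(z \in nbr x) transP V mu x z * f z.
Proof.
apply/esym/fsbig_widen => [|y [_ /mu_eq0]]; first exact: nbrV.
by rewrite /= /transP => ->; rewrite !mul0r.
Qed.

Lemma transP_sumr y (f : E -> R) :
  \sum_(z \in V) f z * transP V mu z y = \sum_(z \in nbr y) f z * transP V mu z y.
Proof.
apply/esym/fsbig_widen => [|z [_ /mu_eq0]]; first exact: nbrV.
by rewrite /= /transP mu_sym => ->; rewrite mul0r mulr0.
Qed.

Lemma stepP_ge0 m x y : 0 <= stepP V mu m x y.
Proof.
elim: m x => [|m IH] x /=; first exact: ler0n.
by apply: fsumr_ge0 => z _; rewrite mulr_ge0// transP_ge0.
Qed.

Lemma finite_stepP m x : finite_set [set y | stepP V mu m x y <> 0].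
Proof.
elim: m x => [|m IH] x /=.
  apply: (sub_finite_set _ (finite_set1 x)) => y /=.
  by case: asboolP => // ->.
apply: (sub_finite_set _ (bigcup_finite (finite_nbr x) (fun z _ => IH z))).
move=> y /=; rewrite transP_suml; apply: contra_notP => /forall2NP h.
apply: fsbig1 => z xz; case: (h z) => // /contrapT ->; exact: mulr0.
Qed.

(** [stepP] is defined by splitting off the first step; splitting off the last one gives the form on
    which reversibility acts. *)
Lemma stepPSr m x y : V x -> V y ->
  stepP V mu m.+1 x y = \sum_(z \in V) stepP V mu m x z * transP V mu z y.
Proof.
move=> Vx Vy; elim: m x Vx => [|m IH] x Vx.
  rewrite /= -(@fsbig_widen _ _ _ _ [set y] V) ?fsbig_set1/=; first last.
  - by move=> z [_ /=]; case: asboolP => // _ _; rewrite mulr0.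
  - by move=> _ ->.
  rewrite -(@fsbig_widen _ _ _ _ [set x] V) ?fsbig_set1/=; first last.
  - move=> z [_ /=]; case: asboolP => // [->//|_ _]; exact: mul0r.
  - by move=> _ ->.
  by rewrite !asboolT// mulr1 mul1r.
(* Restricting both sums to neighbours makes them finite, so that their order can be exchanged. *)
transitivity (\sum_(z \in nbr x) \sum_(w \in nbr y)
    transP V mu x z * stepP V mu m z w * transP V mu w y).
  rewrite [LHS]transP_suml; apply: eq_fsbigr => z /set_mem/nbrV Vz.
  transitivity (transP V mu x z * stepP V mu m.+1 z y); first by [].
  rewrite IH// transP_sumr mulr_fsumr.
  by apply: eq_fsbigr => w _; rewrite mulrA.
rewrite exchange_fsbig; [|exact: finite_nbr|exact: finite_nbr].
rewrite transP_sumr; apply: eq_fsbigr => w _.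
by rewrite /= transP_suml mulr_fsuml.
Qed.

(* Reversibility: the heat kernel from [o] evolves by averaging over neighbours. *)
Lemma pGS m o x : V o -> V x ->
  pG V mu m.+1 o x = \sum_(z \in nbr x) transP V mu x z * pG V mu m o z.
Proof.
move=> Vo Vx; rewrite /pG stepPSr// transP_sumr mulr_fsuml.
apply: eq_fsbigr => z _; rewrite /transP (mu_sym z x); ring.
Qed.

Lemma pG_ge0 m o x : 0 <= pG V mu m o x.
Proof. by rewrite divr_ge0 ?stepP_ge0 ?muv_ge0. Qed.

Lemma qG_ge0 m o x : 0 <= qG V mu m o x.
Proof. by rewrite divr_ge0// addr_ge0// pG_ge0. Qed.

Lemma qGS m o x : V o -> V x ->
  qG V mu m.+1 o x = \sum_(z \in nbr x) transP V mu x z * qG V mu m o z.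
Proof.
move=> Vo Vx; rewrite /qG !pGS// -fsbig_split; last exact: finite_nbr.
rewrite mulr_fsuml; apply: eq_fsbigr => z _; rewrite /=; ring.
Qed.

(** Each time step replaces the kernel by its average over neighbours, with weights [transP] summing
    to one, so an upper bound over all vertices persists. *)
Lemma qG_le_mono m k o c : (m <= k)%N -> V o ->
  (forall x, V x -> qG V mu m o x <= c) -> forall x, V x -> qG V mu k o x <= c.
Proof.
move=> mk Vo; move: mk => /subnK <-; elim: (k - m)%N => // {k} k IH qc x Vx.
rewrite addSn qGS//.
apply: (@le_trans _ _ (\sum_(z \in nbr x) transP V mu x z * c)).
  apply: le_fsumr => [|z xz]; first exact: finite_nbr.
  by rewrite ler_wpM2l ?transP_ge0// IH//; exact: nbrV xz.
rewrite -mulr_fsuml /transP -mulr_fsuml -muv_nbr divff ?mul1r//.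
by rewrite gt_eqF// muv_gt0.
Qed.

(** [qG V mu m o y * muv V mu y] is the mean of the probabilities of being at [y] at times [m] and
    [m.+1]. Summing over [A] turns pointwise bounds on the kernel into bounds relative to volume. *)
Lemma probIn_nuG m o (A : set E) lo hi : 0 <= hi ->
  (forall y, V y -> A y -> lo <= qG V mu m o y <= hi) ->
  (lo%:E * nuG V mu A <= ((probIn V mu m o A + probIn V mu m.+1 o A) / 2)%:E
    <= hi%:E * nuG V mu A)%E.
Proof.
move=> hi0 hq; set S := V `&` A.
(* A finite set outside which both step distributions vanish. *)
pose U := [set y | stepP V mu m o y <> 0] `|` [set y | stepP V mu m.+1 o y <> 0].
have fU : finite_set (S `&` U).
  by apply: finite_setIr; rewrite finite_setU; split; exact: finite_stepP.
have probU k : (k = m \/ k = m.+1) ->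
    probIn V mu k o A = \sum_(y \in S `&` U) stepP V mu k o y.
  move=> mk; apply/esym/fsbig_widen => [y []//|y [Sy /not_andP[//|/not_orP[h1 h2]]]].
  by case: mk => ->; [move: h1|move: h2] => /contrapT.
have qU y : S y -> ~ U y -> qG V mu m o y * muv V mu y = 0.
  by move=> _ /not_orP[/contrapT h1 /contrapT h2]; rewrite /qG /pG h1 h2 !(mul0r, addr0).
have -> : (probIn V mu m o A + probIn V mu m.+1 o A) / 2
    = \sum_(y \in S) qG V mu m o y * muv V mu y.
  rewrite !probU; [|by right|by left].
  rewrite -fsbig_split//= mulr_fsuml -(@fsbig_widen _ _ _ _ (S `&` U) S); first last.
  - by move=> y [Sy /not_andP[//|]]; exact: qU.
  - by move=> y [].
  apply: eq_fsbigr => y /set_mem[[/muv_gt0/gt_eqF/negbT my _] _].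
  by rewrite /qG /pG /=; field.
apply: fsum_esum_bounds => //.
- apply: sub_finite_set fU => y [Sy /= h]; split=> //; apply: contrapT; exact/(contra_not (qU _ Sy)).
- by move=> y _; rewrite mulr_ge0 ?qG_ge0 ?muv_ge0.
- exact: muv_ge0.
- by move=> y [Vy Ay]; case/andP: (hq y Vy Ay) => *; rewrite !ler_wpM2r ?muv_ge0.
Qed.

End WeightedGraph.

(** * Compactness, midpoints and uniform continuity in a metric space *)

Section Metric.
Variables (R : realType) (E : Type) (dE : E -> E -> R).
Hypothesis mE : is_metric dE.

Lemma dist_sym x y : dE x y = dE y x. Proof. by case: mE. Qed.

Lemma dist_tri x y z : dE x z <= dE x y + dE y z. Proof. by case: mE. Qed.

Lemma dist_ge0 x y : 0 <= dE x y. Proof. by case: mE. Qed.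

Lemma distxx x : dE x x = 0. Proof. by case: mE => _ + _ _ => /(_ x x)[_ ->]. Qed.

Lemma dball_center x r : 0 < r -> dball dE x r x.
Proof. by rewrite /dball /= distxx. Qed.

Lemma dopen_dball x r : dopen dE (dball dE x r).
Proof.
rewrite /dball => y /= xy; exists (r - dE x y); first by rewrite subr_gt0.
by move=> z; rewrite /dball/= => yz; have := dist_tri x y z; lra.
Qed.

(** The balls given by the hypothesis cover [K]; the largest threshold in a finite subcover serves
    all of [K]. *)
Lemma dcompact_eventually (K : set E) (P : nat -> E -> Prop) :
  dcompact dE K ->
  (forall x, K x -> exists r N, 0 < r /\
     forall n, (N <= n)%N -> forall y, K y -> dE x y < r -> P n y) ->
  exists N, forall n, (N <= n)%N -> forall y, K y -> P n y.
Proof.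
move=> cK H; have /choice[rN HrN] : forall x, exists p : R * nat, K x ->
    0 < p.1 /\ forall n, (p.2 <= n)%N -> forall y, K y -> dE x y < p.1 -> P n y.
  move=> x; have [Kx|nKx] := pselect (K x); last by exists (0, 0%N).
  by have [r [N h]] := H x Kx; exists (r, N).
have [|x Kx|J [fJ KJ]] := cK {x | K x} (fun i => dball dE (projT1 i) (rN (projT1 i)).1).
- by move=> i; exact: dopen_dball.
- by exists (exist _ x Kx) => //; apply: dball_center; have [] := HrN x Kx.
have [M HM] : exists M, forall i, J i -> ((rN (projT1 i)).2 <= M)%N.
  have /finite_seqP[s sE] : finite_set [set (rN (projT1 i)).2 | i in J] by exact: finite_image.
  exists (\max_(k <- s) k)%N => i Ji; apply: leq_bigmax_seq => //.
  by have : [set` s] (rN (projT1 i)).2 by rewrite -sE; exists i.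
exists M => n Mn y Ky; have [i Ji yi] := KJ y Ky.
have [_ h] := HrN _ (projT2 i); apply: h => //.
exact: leq_trans (HM i Ji) Mn.
Qed.

(** For [x] outside [F], the bound [n.+1%:R^-1 < dE x y] holds for large [n] locally in [y], hence
    uniformly on the compact part of [F] in the unit ball, so [F] stays away from [x]. *)
Lemma dclosed_locally_compact (F : set E) :
  (forall x r, 0 < r -> dcompact dE (F `&` dcball dE x r)) -> dopen dE (~` F).
Proof.
move=> cF x nFx; have [N HN] : exists N, forall n, (N <= n)%N -> forall y,
    (F `&` dcball dE x 1) y -> n.+1%:R^-1 < dE x y.
  apply: dcompact_eventually; first exact: cF.
  move=> y [Fy _]; have xy : 0 < dE x y.
    rewrite lt_neqAle dist_ge0 andbT eq_sym; apply/eqP; case: mE => _ h _ _.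
    by move/h => xy; apply: nFx; rewrite xy.
  have xy2 : 0 < dE x y / 2 by rewrite divr_gt0.
  exists (dE x y / 2), (Num.truncn (dE x y / 2)^-1); split=> // n Nn z _ yz.
  have : (dE x y / 2)^-1 < n.+1%:R by rewrite -truncn_le_nat.
  rewrite invf_plt ?posrE// => h; have := dist_tri x z y; rewrite (dist_sym z y).
  by move: (n.+1%:R^-1) h => u; lra.
exists (Num.min 1 N.+1%:R^-1); first by rewrite lt_min ltr01 invr_gt0 ltr0n.
move=> y; rewrite /dball/= lt_min => /andP[xy1 xyN] Fy.
by have := HN N (leqnn N) y (conj Fy (ltW xy1)); rewrite ltNge ltW.
Qed.

(* Halving the segment from [o] to [x] repeatedly reaches any scale below [dE o x]. *)
Lemma midpoint_scale (F : set E) o x r :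
  (forall x y, F x -> F y -> exists z, [/\ F z,
      dE x z = dE x y / 2 & dE z y = dE x y / 2]) ->
  F o -> F x -> 0 < r -> r <= dE o x ->
  exists z, [/\ F z, r <= dE o z < r * 2 & dE z x <= dE o x - dE o z].
Proof.
move=> mid Fo Fx r0 rox.
have [k kr] : exists k, dE o x < r * 2 ^+ k.
  exists (Num.truncn (dE o x / r)).+1; rewrite -ltr_pdivrMl// mulrC.
  apply: (@lt_le_trans _ _ (Num.truncn (dE o x / r)).+1%:R); first by rewrite -truncn_le_nat.
  by rewrite -natrX ler_nat ltnW// ltn_expl.
(* The invariant [dE z x <= dE o x - dE o z] says that no length is lost by passing through [z] on
   the way from [o] to [x]. *)
suff : forall k z, F z -> r <= dE o z -> dE z x <= dE o x - dE o z -> dE o z < r * 2 ^+ k ->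
    exists z, [/\ F z, r <= dE o z < r * 2 & dE z x <= dE o x - dE o z].
  by apply; [exact: Fx|exact: rox| rewrite subrr distxx|exact: kr].
elim=> [|{kr}k IH] z Fz rz zx zk; first by exfalso; move: zk; rewrite expr0; lra.
have [z2|z2] := ltP (dE o z) (r * 2); first by exists z; rewrite rz.
have [w [Fw ow wz]] := mid o z Fo Fz.
apply: (IH w Fw); first by lra.
  by have := dist_tri w z x; lra.
by move: zk; rewrite exprS; lra.
Qed.

(** A tube argument: continuity at each [(t, x)] is made uniform over the compact interval [[a, b]].
    The time [s] is bounded only from below, so it may slightly exceed [b]. *)
Lemma unif_time (F : set E) (q : R -> E -> R) (a b eps : R) x :
  (forall t x, 0 < t -> F x -> forall eps, 0 < eps ->
      exists2 del, 0 < del & forall s y, 0 < s -> F y ->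
        `|s - t| < del -> dE x y < del -> `|q s y - q t x| < eps) ->
  0 < a -> F x -> 0 < eps ->
  exists2 del, 0 < del & forall t s y z, a <= t <= b -> a <= s -> F y -> F z ->
    `|s - t| < del -> dE x y < del -> dE x z < del -> `|q s y - q t z| < eps.
Proof.
move=> qc a0 Fx eps0.
have eps2 : 0 < eps / 2 by rewrite divr_gt0.
have H : \forall del \near 0^'+, `[a, b] `<=` [set t | a <= t -> forall s y z, a <= s ->
    F y -> F z -> `|s - t| < del -> dE x y < del -> dE x z < del ->
    `|q s y - q t z| < eps].
  apply: (compact_near_coveringP `[a, b]).1; first exact: segment_compact.
  move=> t /=; rewrite in_itv/= => /andP[ta tb].
  have t0 := lt_le_trans a0 ta; have [del del0 Hd] := qc t x t0 Fx _ eps2.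
  have del2 : 0 < del / 2 by rewrite divr_gt0.
  exists (ball t (del / 2), [set u | u < del / 2]); first split => /=.
  - exact: nbhsx_ballx.
  - exact: nbhs_right_lt.
  move=> [t' u] [/= tt' u2] at' s y z as_ Fy Fz st' xy xz.
  have t'0 := lt_le_trans a0 at'; have s0 := lt_le_trans a0 as_.
  move: tt'; rewrite /ball/= distrC => tt'.
  have h1 : `|q s y - q t x| < eps / 2.
    apply: Hd => //; last lra.
    by have := ler_distD t' s t; lra.
  have h2 : `|q t' z - q t x| < eps / 2 by apply: Hd => //; lra.
  by have := ler_distD (q t x) (q s y) (q t' z); rewrite (distrC (q t x)); lra.
near (0 : R)^'+ => del; exists del => // t s y z tab.
have /andP[ta _] := tab.
by have := near H del; apply => //=; rewrite in_itv.
Unshelve. all: by end_near.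
Qed.

End Metric.

(** * Borel measurability and integral bounds *)

Section Measure.
Variables (R : realType) (d : measure_display) (E : measurableType d).
Variables (dE : E -> E -> R) (F : set E) (nu : {measure set E -> \bar R}).
Hypotheses (mE : is_metric dE) (bE : borel_of_metric dE).

Lemma measurable_dopen A : dopen dE A -> measurable A.
Proof. by move=> oA; rewrite bE; exact: sub_sigma_algebra. Qed.

Lemma measurable_dball x r : measurable (dball dE x r).
Proof. by apply: measurable_dopen; exact: dopen_dball. Qed.

Lemma measurable_dcball x r : measurable (dcball dE x r).
Proof.
rewrite -[dcball _ _ _]setCK; apply: measurableC; apply: measurable_dopen.
rewrite /dcball => y /= /negP; rewrite -ltNge => xy.
exists (dE x y - r); first by rewrite subr_gt0.
move=> z; rewrite /dball/= => yz xz.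
by have := dist_tri mE x z y; rewrite (dist_sym mE z y); lra.
Qed.

Lemma measurable_dclosed : dopen dE (~` F) -> measurable F.
Proof. by move=> /measurable_dopen/measurableC; rewrite setCK. Qed.

(** Continuity is relative to [F], so the set where [f > c] is written as the trace on [F] of an
    open set of [E]: the union of the balls on whose points of [F] the function exceeds [c]. *)
Lemma measurable_fun_dcontinuous (f : E -> R) :
  (forall x, F x -> forall eps, 0 < eps ->
      exists2 del, 0 < del & forall y, F y -> dE x y < del -> `|f y - f x| < eps) ->
  measurable_fun F f.
Proof.
move=> fc mF; apply: (measurability _ (RGenOInfty.measurableE R)) => //.
move=> _ [_ [c ->] <-].
have -> : F `&` f @^-1` `]c, +oo[ = F `&` [set y | exists x r,
    [/\ dE x y < r & forall z, F z -> dE x z < r -> c < f z]].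
  apply/seteqP; split=> y [Fy]; rewrite /= ?in_itv/= ?andbT.
  - move=> cy; have [|r r0 h] := fc y Fy (f y - c); first by rewrite subr_gt0.
    split=> //; exists y, r; split; first by rewrite distxx.
    by move=> z Fz /(h z Fz); rewrite ltr_norml => /andP[]; lra.
  - by move=> [x [r [xy h]]]; split=> //; exact: h.
apply: measurableI => //; apply: measurable_dopen => y [x [r [xy h]]].
have [e e0 he] := dopen_dball mE (xy : dball dE x r y).
by exists e => // z /he xz; exists x, r.
Qed.

(** Integrals are compared for nonnegative functions only; when [lo] is not positive, the lower
    bound follows from [f] being nonnegative. *)
Lemma integral_bounds A (f : E -> R) lo hi v : measurable A -> measurable_fun A f ->
  nu A = v%:E -> 0 <= hi -> (forall x, A x -> 0 <= f x) ->
  (forall x, A x -> lo <= f x <= hi) ->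
  ((lo * v)%:E <= \int[nu]_(x in A) (f x)%:E <= (hi * v)%:E)%E.
Proof.
move=> mA mf nuA hi0 f0 fb.
have v0 : 0 <= v by rewrite -lee_fin -nuA.
have mf' : measurable_fun A (fun x => (f x)%:E) by exact/measurable_EFinP.
apply/andP; split.
- have [lo0|lo0] := leP lo 0.
    apply: (@le_trans _ _ 0%E); first by rewrite lee_fin mulr_le0_ge0.
    by apply: integral_ge0 => x /f0; rewrite lee_fin.
  rewrite EFinM -nuA -integral_cst//; apply: ge0_le_integral => //.
  + by move=> x _; rewrite lee_fin ltW.
  + by move=> x /fb/andP[]; rewrite lee_fin.
- rewrite EFinM -nuA -integral_cst//; apply: ge0_le_integral => //.
  by move=> x /fb/andP[]; rewrite lee_fin.
Qed.

End Measure.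

(** * Limits in eventual form, and the squeeze inequality *)

Lemma cvg_pinfty_eventually (R : realType) (u : nat -> R) :
  u @ \oo --> +oo -> forall A, exists N, forall n, (N <= n)%N -> A <= u n.
Proof. by move=> /cvgryPge h A; have [N _ HN] := h A; exists N. Qed.

Lemma cvg_fin_eventually (R : realType) (u : nat -> \bar R) (l : R) :
  u @ \oo --> l%:E -> forall e, 0 < e -> exists N, forall n, (N <= n)%N ->
    exists2 r, u n = r%:E & `|r - l| < e.
Proof.
move=> /fine_cvgP[[N1 _ H1] /cvgrPdist_lt h] e /h[N2 _ H2].
exists (maxn N1 N2) => n; rewrite geq_max => /andP[/H1/= n1 /H2/= n2].
by exists (fine (u n)); rewrite ?fineK// distrC.
Qed.

(** The nonnegative element keeps each supremum away from [-oo], so a uniform upper bound makes it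
    eventually finite. *)
Lemma ereal_sup_cvg0 (R : realType) (S : nat -> set \bar R) :
  (forall n, exists2 y, S n y & (0 <= y)%E) ->
  (forall e : R, 0 < e -> exists N, forall n, (N <= n)%N ->
     forall y, S n y -> (y <= e%:E)%E) ->
  (fun n => ereal_sup (S n)) @ \oo --> 0%E.
Proof.
move=> S0 H.
have sup_le (e : R) n : (forall y, S n y -> (y <= e%:E)%E) ->
    (0 <= ereal_sup (S n) <= e%:E)%E.
  by move=> h; rewrite le_ereal_sup_tmp//= ge_ereal_sup.
apply/fine_cvgP; split.
  have [N HN] := H 1 ltr01; exists N => // n /= /HN/sup_le/andP[h0 h1].
  by rewrite fin_numE; case: (ereal_sup _) h0 h1.
apply/cvgrPdist_le => e e0; have [N HN] := H e e0; exists N => // n /= /HN/sup_le/andP[].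
case: (ereal_sup _) => //= r; rewrite !lee_fin => h0 h1.
by rewrite sub0r normrN ger0_norm.
Qed.

(** Here [c] is the rescaled heat kernel, [Q] the limit density, [S] the averaged probability of a
    ball, [N] and [v] its rescaled and limiting volumes. The 7 adds up [e] for the oscillation of
    [c], [2 * e] for the error in [S], and at most [e + 3 * e] for replacing [N] by [v], from
    [e' * Q <= e] and [6 * e * e' <= 3 * e]. *)
Lemma ratio_squeeze (R : realType) (c Q S N v e e' : R) :
  0 < v -> 0 <= c -> 0 <= Q -> 0 < e -> 0 < e' -> e' <= 2^-1 -> e' * Q <= e ->
  `|N - v| <= e' * v -> (c - e) * N <= S <= (c + e) * N ->
  (Q - 2 * e) * v <= S <= (Q + 2 * e) * v -> `|c - Q| <= 7 * e.
Proof.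
move=> v0 c0 Q0 e0 e'0 e'2 e'Q Nv /andP[S1 S2] /andP[S3 S4].
move: Nv; rewrite ler_norml => /andP[N1 N2].
have e'v : e' * v <= 2^-1 * v by rewrite ler_pM2r.
rewrite ler_norml; apply/andP; split; rewrite leNgt; apply/negP => h.
- have : (c + e) * N <= (Q - 6 * e) * ((1 + e') * v).
    apply: ler_pM; lra.
  suff : (Q - 6 * e) * (1 + e') * v < (Q - 2 * e) * v by lra.
  by rewrite ltr_pM2r//; nra.
- have : (Q + 6 * e) * ((1 - e') * v) <= (c - e) * N.
    by apply: ler_pM; nra.
  suff : (Q + 2 * e) * v < (Q + 6 * e) * (1 - e') * v by nra.
  by rewrite ltr_pM2r//; nra.
Qed.

Lemma flrS (R : realType) (x : R) : 0 <= x -> flr (x + 1) = (flr x).+1.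
Proof.
move=> x0; apply: truncn_def; have /andP[] := truncn_itv x0.
by rewrite -!natr1 -/(flr x); lra.
Qed.

(** * Uniform convergence of the rescaled heat kernels *)

Theorem theorem1p2
  (R : realType) (d : measure_display) (E : measurableType d)
  (dE : E -> E -> R) (F : set E) (rho : E)
  (nu : {measure set E -> \bar R}) (q : R -> E -> R)
  (V : nat -> set E) (mu : nat -> E -> E -> R)
  (alpha beta gamma : nat -> R) (g : nat -> E -> E) (T1 : R)
  (* setting *)
  (hdE : is_metric dE)
  (hborel : borel_of_metric dE)
  (hFcomp : forall x r, 0 < r -> dcompact dE (F `&` dcball dE x r))
  (hrho : F rho)
  (hnu_carried : carried_by F nu)
  (hnu_radon : radon_on dE F nu)
  (hnu_full : full_support_on dE F nu)
  (hq_cont : forall t x, 0 < t -> F x -> forall eps, 0 < eps ->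
      exists2 del, 0 < del & forall s y, 0 < s -> F y ->
        `|s - t| < del -> dE x y < del -> `|q s y - q t x| < eps)
  (hq_ge0 : forall t x, 0 < t -> F x -> 0 <= q t x)
  (hq_int : forall t, 0 < t -> (\int[nu]_(y in F) (q t y)%:E = 1)%E)
  (hG : forall n, good_graph (V n) (mu n))
  (hrhoV : forall n, V n rho)
  (halpha0 : forall n, 0 <= alpha n) (halpha : alpha @ \oo --> +oo)
  (hbeta0 : forall n, 0 <= beta n) (hbeta : beta @ \oo --> +oo)
  (hgamma0 : forall n, 0 <= gamma n) (hgamma : gamma @ \oo --> +oo)
  (hg : forall n x, V n (g n x) /\ forall v, V n v -> dE x (g n x) <= dE x v)
  (hT1 : 0 < T1)
  (* Assumption (A1)(a) *)
  (hA1a1 : exists2 c1, 0 < c1 & forall n x y, V n x -> V n y ->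
      c1 * alpha n * dE x y <= gdist (V n) (mu n) x y)
  (hA1a2 : exists atil : nat -> R,
      (forall n, 0 <= atil n) /\
      (forall eps, 0 < eps -> exists N, forall n, (N <= n)%N -> atil n <= eps * alpha n) /\
      (forall r, 0 < r -> exists c2 : R, exists n0, forall n, (n0 <= n)%N ->
         forall x y, V n x -> dball dE rho r x -> V n y -> dball dE rho r y ->
           gdist (V n) (mu n) x y <= c2 * alpha n * dE x y + atil n))
  (* Assumption (A1)(b) *)
  (hA1b : forall r, 0 < r ->
      (fun n => ereal_sup [set (dist_set dE x (V n))%:E | x in dball dE rho r `&` F])
        @ \oo --> 0%E)
  (* Assumption (A1)(c) *)
  (hA1c : forall x r, F x -> 0 < r ->
      (fun n => ((beta n)^-1)%:E * nuG (V n) (mu n) (dball dE x r))%E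
        @ \oo --> nu (dball dE x r))
  (* Assumption (A1)(d) *)
  (hA1d : forall a b, 0 < a -> a <= b -> forall x r, F x -> 0 < r ->
      forall eps, 0 < eps -> exists N, forall n, (N <= n)%N -> forall t, a <= t <= b ->
        (`| (probIn (V n) (mu n) (flr (gamma n * t)) rho (dball dE x r))%:E
            - \int[nu]_(y in dball dE x r `&` F) (q t y)%:E | <= eps%:E)%E)
  (* Assumption (A2) *)
  (hA2 : forall a b, 0 < a -> a <= b -> forall r, 0 < r ->
      forall eps, 0 < eps -> exists2 del0, 0 < del0 & forall del, 0 < del < del0 ->
        exists N, forall n, (N <= n)%N -> forall x y,
          gball (V n) (mu n) rho (alpha n * r) x ->
          gball (V n) (mu n) rho (alpha n * r) y ->
          gdist (V n) (mu n) x y <= alpha n * del ->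
          forall t, a <= t <= b ->
            beta n * `| qG (V n) (mu n) (flr (gamma n * t)) rho x
                        - qG (V n) (mu n) (flr (gamma n * t)) rho y | <= eps)
  (* Assumption (A3): midpoint property *)
  (hA3mid : forall x y, F x -> F y -> exists z, [/\ F z,
      dE x z = dE x y / 2 & dE z y = dE x y / 2])
  (* Assumption (A3)(a) *)
  (hA3a1 : forall eps, 0 < eps -> exists2 T, 0 < T &
      forall t, T <= t -> forall x, F x -> q t x <= eps)
  (hA3a2 : forall a b, 0 < a -> a <= b -> forall eps, 0 < eps -> exists R0 : R,
      forall r, R0 <= r -> forall x, F x -> ~ dball dE rho r x ->
        forall t, a <= t <= b -> q t x <= eps)
  (* Assumption (A3)(b) *)
  (hA3b1 : forall eps, 0 < eps -> exists2 T, 0 < T & forall t, T <= t ->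
      exists N, forall n, (N <= n)%N -> forall x, V n x ->
        beta n * qG (V n) (mu n) (flr (gamma n * t)) rho x <= eps)
  (hA3b2 : forall a b, 0 < a -> a <= b -> forall eps, 0 < eps -> exists R0 : R,
      forall r, R0 <= r -> exists N, forall n, (N <= n)%N -> forall x, V n x ->
        ~ gball (V n) (mu n) rho (alpha n * r) x ->
        forall t, a <= t <= b ->
          beta n * qG (V n) (mu n) (flr (gamma n * t)) rho x <= eps) :
  (fun n => ereal_sup [set e | exists x t, [/\ F x, T1 <= t &
      e = (`| beta n * qG (V n) (mu n) (flr (gamma n * t)) rho (g n x) - q t x |)%:E]])
    @ \oo --> 0%E.
Proof.
pose Q n t y := beta n * qG (V n) (mu n) (flr (gamma n * t)) rho y.
have FO := dclosed_locally_compact hdE hFcomp.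
have mF : measurable F := measurable_dclosed hborel FO.
have hgV n x : V n (g n x) by have [] := hg n x.
have near_g r e : 0 < r -> 0 < e -> exists N, forall n, (N <= n)%N ->
    forall x, F x -> dE rho x < r -> dE x (g n x) < e.
  move=> r0 e0; have [N HN] := cvg_fin_eventually (hA1b r r0) e0.
  exists N => n /HN[s Es sE] x Fx rx.
  have : ((dist_set dE x (V n))%:E <= s%:E)%E.
    by rewrite -Es; apply: ereal_sup_ubound; exists x.
  have : dE x (g n x) <= dist_set dE x (V n).
    apply: lb_le_inf; first by exists (dE x rho), rho.
    by move=> _ [v Vv <-]; have [_] := hg n x; apply.
  by move: sE; rewrite lee_fin subr0 ltr_norml => /andP[]; lra.
(* Full support makes the volume positive; the Radon property on the compact closed ball makes it
   finite. *)
have nu_ball x r : F x -> 0 < r -> exists2 v, 0 < v & nu (dball dE x r `&` F) = v%:E.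
  move=> Fx r0; have h0 : (0 < nu (dball dE x r `&` F))%E.
    apply: hnu_full; first exact: dopen_dball.
    by exists x; split=> //; exact: dball_center.
  have : (nu (dball dE x r `&` F) < +oo)%E.
    have [hK _] := hnu_radon.
    have cK := hFcomp x r r0.
    have mK : measurable (F `&` dcball dE x r).
      by apply: measurableI => //; exact: measurable_dcball.
    apply: le_lt_trans (hK _ cK _); last by move=> y [].
    apply: le_measure; rewrite ?inE//.
      by apply: measurableI => //; exact: measurable_dball.
    by move=> y [yx Fy]; split=> //; exact: ltW.
  case: (nu _) h0 => // v; rewrite lte_fin => v0 _; by exists v.
have q_meas t : 0 < t -> measurable_fun F (q t).
  move=> t0; apply: (measurable_fun_dcontinuous hdE hborel) => // x Fx eps eps0.
  have [del del0 H] := hq_cont t x t0 Fx eps eps0.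
  by exists del => // y Fy xy; apply: H; rewrite ?subrr ?normr0.

(* The estimate near a point of [F] on a compact time interval *)
have local a b e x0 : 0 < a -> a <= b -> 0 < e -> F x0 -> exists r N, 0 < r /\
    forall n, (N <= n)%N -> forall x, F x -> dE x0 x < r ->
    forall t, a <= t <= b -> `|Q n t (g n x) - q t x| <= 7 * e.
  move=> a0 ab e0 Fx0.
  (* The extra unit of time leaves room for [t + (gamma n)^-1], the time matching step [m.+1]. *)
  have b1 : a <= b + 1 by lra.
  have [del1 del10 Hdel1] := unif_time (b + 1) hq_cont a0 Fx0 e0.
  (* [R1] covers both the points within [r <= 1] of [x0] and their images under [g n], at most [r]
     further away. *)
  pose R1 := dE rho x0 + 2; have R10 : 0 < R1 by have := dist_ge0 hdE rho x0; rewrite /R1; lra.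
  have [atil [_ [atil_small /(_ R1 R10)[c2 [N1 Hc2]]]]] := hA1a2.
  pose C := Num.max c2 0; have C0 : 0 <= C by rewrite le_max lexx orbT.
  have c2C : c2 <= C by rewrite le_max lexx.
  (* A graph radius, in units of [alpha n], reaching all vertices within [R1] of [rho]; the summand
     1 absorbs [atil n]. *)
  have RA0 : 0 < C * R1 + 1 by rewrite ltr_wpDl// mulr_ge0// ltW.
  have [del0 del00 /(_ (del0 / 2))[|N2 HN2]] := hA2 a b a0 ab _ RA0 e e0; first by lra.
  (* Vertices of the ball lie within [3 * r] of [g n x], which costs [del0 / 4] in units of
     [alpha n]; [atil n] costs another [del0 / 4], and (A2) is used at scale [del0 / 2]. *)
  pose r := Num.min (Num.min del1 1) (del0 / (12 * (C + 1))).
  have r0 : 0 < r by rewrite !lt_min del10 ltr01 divr_gt0// mulr_gt0//; lra.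
  have r1 : r <= 1 by rewrite !ge_min lexx orbT.
  have rdel1 : r <= del1 by rewrite !ge_min lexx.
  have rC : C * (3 * r) <= del0 / 4.
    have : r <= del0 / (12 * (C + 1)) by rewrite !ge_min lexx orbT.
    rewrite ler_pdivlMr; last by rewrite mulr_gt0//; lra.
    by move: C0 r0; nra.
  pose B := dball dE x0 r; have mB : measurable B by exact: measurable_dball.
  have mBF : measurable (B `&` F) by exact: measurableI.
  have [v v0 nuv] := nu_ball x0 r Fx0 r0.
  have nuB : nu B = v%:E by rewrite hnu_carried.
  (* It will be shown that [q t x <= e + v^-1], so this choice gives [e' * q t x <= e]. *)
  pose e' := Num.min 2^-1 (e / (e + v^-1)).
  have ev0 : 0 < e + v^-1 by rewrite addr_gt0 ?invr_gt0.
  have e'0 : 0 < e' by rewrite lt_min invr_gt0 ltr0n divr_gt0.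
  have [N3 HN3] : exists N, forall n, (N <= n)%N -> exists2 w,
      ((beta n)^-1%:E * nuG (V n) (mu n) B)%E = w%:E & `|w - v| < e' * v.
    by apply: cvg_fin_eventually; rewrite ?mulr_gt0// -nuB; exact: hA1c.
  have [N4 HN4] := hA1d a (b + 1) a0 b1 x0 r Fx0 r0 (e * v) (mulr_gt0 e0 v0).
  have [N5 HN5] := near_g R1 r R10 r0.
  have [N6 HN6] := cvg_pinfty_eventually hbeta 1.
  have [N7 HN7] := cvg_pinfty_eventually hgamma (1 + del1^-1).
  have [|N8 HN8] := atil_small (Num.min (del0 / 4) 2^-1).
    by rewrite lt_min divr_gt0//= invr_gt0.
  have [N9 HN9] := cvg_pinfty_eventually halpha 1.
  exists r, (maxn N1 (maxn N2 (maxn N3 (maxn N4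
    (maxn N5 (maxn N6 (maxn N7 (maxn N8 N9)))))))); split=> // n.
  rewrite !geq_max => /and5P[m1 m2 m3 m4 /and5P[m5 m6 m7 m8 m9]] x Fx x0x t tab.
  have /andP[ta tb] := tab.
  have t0 : 0 < t := lt_le_trans a0 ta.
  have al0 : 0 < alpha n by apply: lt_le_trans (HN9 n m9).
  have be0 : 0 < beta n by apply: lt_le_trans (HN6 n m6).
  have di0 : 0 < del1^-1 by rewrite invr_gt0.
  have ga0 : 0 < gamma n by have := HN7 n m7; lra.
  have gai : (gamma n)^-1 < del1 by rewrite invf_plt ?posrE//; have := HN7 n m7; lra.
  have gai1 : (gamma n)^-1 <= 1 by rewrite invf_le1//; have := HN7 n m7; lra.
  have at1 : atil n <= del0 / 4 * alpha n.
    by apply: le_trans (HN8 n m8) _; rewrite ler_pM2r// ge_min lexx.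
  have at2 : atil n <= 2^-1 * alpha n.
    by apply: le_trans (HN8 n m8) _; rewrite ler_pM2r// ge_min lexx orbT.
  have xgx : dE x (g n x) < r.
    apply: (HN5 n m5 x Fx); have := dist_tri hdE rho x0 x.
    by move: x0x r1; rewrite /R1; lra.
  have rgx : dE rho (g n x) < R1.
    have := dist_tri hdE rho x0 (g n x); have := dist_tri hdE x0 x (g n x).
    by move: x0x r1 xgx; rewrite /R1; lra.
  have gdist_le y y' D : V n y -> V n y' -> dE rho y < R1 -> dE rho y' < R1 ->
      dE y y' <= D -> gdist (V n) (mu n) y y' <= alpha n * (C * D) + atil n.
    move=> Vy Vy' ry ry' yy'.
    apply: le_trans (Hc2 n m1 y y' Vy ry Vy' ry') _; rewrite lerD2r.
    rewrite (mulrC c2) -mulrA ler_pM2l//.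
    by apply: (@le_trans _ _ (C * dE y y')); rewrite ?ler_wpM2r ?ler_wpM2l// dist_ge0.
  have gball_rho y : V n y -> dE rho y < R1 ->
      gball (V n) (mu n) rho (alpha n * (C * R1 + 1)) y.
    move=> Vy ry; split=> //; have rr : dE rho rho < R1 by rewrite distxx.
    apply: le_lt_trans (gdist_le _ _ R1 (hrhoV n) Vy rr ry (ltW ry)) _.
    by rewrite mulrDr; lra.
  have osc y : V n y -> B y ->
      beta n * `|qG (V n) (mu n) (flr (gamma n * t)) rho y -
                 qG (V n) (mu n) (flr (gamma n * t)) rho (g n x)| <= e.
    rewrite /B /dball/= => Vy x0y.
    have ry : dE rho y < R1 by have := dist_tri hdE rho x0 y; rewrite /R1; lra.
    apply: (HN2 n m2) => //; [exact: gball_rho|exact: gball_rho|].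
    apply: le_trans (gdist_le y (g n x) (3 * r) _ _ _ _ _) _ => //.
      have := dist_tri hdE y x0 (g n x); have := dist_tri hdE x0 x (g n x).
      by rewrite (dist_sym hdE y x0); lra.
    have := ler_wpM2l (ltW al0) rC; lra.
  pose m := flr (gamma n * t).
  have q0 : 0 <= q t x by exact: hq_ge0.
  have int_bounds s : a <= s -> `|s - t| < del1 ->
      (((q t x - e) * v)%:E <= \int[nu]_(y in B `&` F) (q s y)%:E
        <= ((q t x + e) * v)%:E)%E.
    move=> sa st; have s0 : 0 < s := lt_le_trans a0 sa.
    have mq : measurable_fun (B `&` F) (q s).
      by apply: measurable_funS (q_meas s s0) => // y [].
    apply: integral_bounds => //; first by rewrite addr_ge0// ltW.
      by move=> y [_ Fy]; exact: hq_ge0.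
    move=> y [By Fy]; have : `|q s y - q t x| < e.
      by apply: Hdel1 => //; [lra|exact: lt_le_trans By rdel1|exact: lt_le_trans x0x rdel1].
    by rewrite ltr_norml => /andP[]; lra.
  have prob_bounds k s : a <= s <= b + 1 -> k = flr (gamma n * s) -> `|s - t| < del1 ->
      (q t x - 2 * e) * v <= probIn (V n) (mu n) k rho B <= (q t x + 2 * e) * v.
    move=> sab -> st; have /andP[sa _] := sab.
    have := HN4 n m4 s sab; have := int_bounds s sa st; rewrite -/B.
    case: (\int[nu]_(y in _) _)%E => [i| |]; rewrite ?leye_eq ?leeNy_eq ?andbF//=.
    rewrite !lee_fin => /andP[i1 i2].
    by rewrite ler_norml => /andP[i3 i4]; apply/andP; split; lra.
  (* On the ball [q t] is at least [q t x - e], while its integral there is at most one. *)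
  have qe : e' * q t x <= e.
    have : (q t x - e) * v <= 1.
      have tt : `|t - t| < del1 by rewrite subrr normr0.
      have /andP[i1 _] := int_bounds t ta tt.
      rewrite -lee_fin -(hq_int t t0); apply: le_trans i1 _.
      apply: ge0_subset_integral => //.
      - exact/measurable_EFinP/q_meas.
      - by move=> y Fy; rewrite lee_fin hq_ge0.
    rewrite -ler_pdivlMr// mul1r lerBlDl => qv.
    apply: (@le_trans _ _ (e / (e + v^-1) * (e + v^-1))); last by rewrite divfK// gt_eqF.
    by apply: ler_pM => //; [exact: ltW|rewrite ge_min lexx orbT].
  have [w Nw wv] := HN3 n m3.
  apply: (@ratio_squeeze _ _ _ ((probIn (V n) (mu n) m rho B + probIn (V n) (mu n) m.+1 rho B) / 2) w v e e') => //.
  - by rewrite mulr_ge0 ?qG_ge0.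
  - by rewrite ge_min lexx.
  - exact: ltW.
  - have be0' : (beta n)^-1 * beta n = 1 by rewrite mulVf// gt_eqF.
    have nuw : nuG (V n) (mu n) B = (beta n * w)%:E.
      rewrite EFinM -Nw muleA -EFinM mulrC be0' mul1e //.
    have := @probIn_nuG _ _ _ _ (hG n) m rho B
      ((Q n t (g n x) - e) / beta n) ((Q n t (g n x) + e) / beta n) _ _.
    rewrite nuw -!EFinM !lee_fin !mulrA !divfK ?gt_eqF//; apply.
      apply: divr_ge0 => //; apply: addr_ge0; last exact: ltW.
      by rewrite mulr_ge0 ?qG_ge0.
    move=> y Vy By; rewrite ler_pdivrMr// ler_pdivlMr//.
    have := osc y Vy By; rewrite -{1}(ger0_norm (hbeta0 n)) -normrM mulrBr ler_norml.
    by rewrite /Q -/m => /andP[]; rewrite mulrC; lra.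
  - have /andP[h1 h2] : (q t x - 2 * e) * v <= probIn (V n) (mu n) m rho B <= (q t x + 2 * e) * v.
      by apply: (prob_bounds m t) => //; [rewrite ta/=; lra|rewrite subrr normr0].
    have /andP[h3 h4] : (q t x - 2 * e) * v <= probIn (V n) (mu n) m.+1 rho B <= (q t x + 2 * e) * v.
      (* Step [m.+1] is the integer part of [gamma n] times this shifted time, which is within
         [del1] of [t]. *)
      apply: (prob_bounds m.+1 (t + (gamma n)^-1)).
      + have : 0 < (gamma n)^-1 by rewrite invr_gt0.
        by move=> ?; apply/andP; split; lra.
      + by rewrite mulrDr divff ?gt_eqF// flrS// mulr_ge0// ltW.
      + by rewrite addrAC subrr add0r gtr0_norm// invr_gt0.
    by apply/andP; split; lra.

(* The estimate far from [rho] on a compact time interval *)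
have far a b e : 0 < a -> a <= b -> 0 < e -> exists r N, 0 < r /\
    forall n, (N <= n)%N -> forall x, F x -> r <= dE rho x ->
    forall t, a <= t <= b -> `|Q n t (g n x) - q t x| <= e.
  move=> a0 ab e0; have [R1 HR1] := hA3a2 a b a0 ab e e0.
  have [R2 HR2] := hA3b2 a b a0 ab e e0; have [c1 c10 Hc1] := hA1a1.
  pose r2 := Num.max R2 1; have r20 : 0 < r2 by rewrite lt_max ltr01 orbT.
  (* The term [2 * r2 / c1] ensures that distance [r / 2] in [E] forces graph distance at least
     [alpha n * r2]. *)
  pose r := Num.max (Num.max R1 1) (2 * r2 / c1).
  have r1 : 1 <= r by rewrite !le_max lexx !orbT.
  have rR1 : R1 <= r by rewrite !le_max lexx.
  have rr2 : r2 <= c1 * (r / 2).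
    rewrite mulrA ler_pdivlMr// -ler_pdivrMl// mulrC (mulrC r2) /r le_max lexx orbT //.
  have r0 : 0 < r by lra.
  have [N1 HN1] : exists N, forall n, (N <= n)%N -> forall x, F x -> dE rho x < r * 2 ->
      dE x (g n x) < r / 2 by apply: near_g; lra.
  have [|N2 HN2] := HR2 r2; first by rewrite le_max lexx.
  exists r, (maxn N1 N2); split=> // n.
  rewrite geq_max => /andP[/HN1 n1 /HN2 n2] x Fx rx t tab.
  have t0 : 0 < t by case/andP: tab => /(lt_le_trans a0).
  (* (A1)(b) controls [g n] only on bounded sets, so it is applied to a point [z] at distance
     between [r] and [2 * r] from [rho], on the way to [x]. *)
  have [z [Fz /andP[rz zr] zx]] := midpoint_scale hdE hA3mid hrho Fx r0 rx.
  (* By minimality [g n x] is no farther from [x] than [g n z] is, hence at least [dE rho z - r / 2]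
     from [rho]. *)
  have gx : r / 2 <= dE rho (g n x).
    have := n1 z Fz zr; have := (hg n x).2 _ (hgV n z).
    have := dist_tri hdE x z (g n z); rewrite (dist_sym hdE x z).
    by have := dist_tri hdE rho (g n x) x; rewrite (dist_sym hdE (g n x) x); lra.
  have : Q n t (g n x) <= e.
    apply: n2 => // -[_]; apply/negP; rewrite -leNgt.
    apply: le_trans (Hc1 n _ _ (hrhoV n) (hgV n x)).
    rewrite (mulrC c1) -mulrA ler_wpM2l//; apply: le_trans rr2 _.
    by rewrite ler_pM2l.
  have : q t x <= e.
    by apply: (HR1 r) => //; rewrite /dball/= => /lt_geF; rewrite rx.
  have : 0 <= Q n t (g n x) by rewrite mulr_ge0 ?qG_ge0.
  have : 0 <= q t x by exact: hq_ge0.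
  by move=> *; rewrite ler_norml; apply/andP; split; lra.

(* The estimate for large times *)
have late e : 0 < e -> exists T N, 0 < T /\
    forall n, (N <= n)%N -> forall x, F x -> 
    forall t, T <= t -> `|Q n t (g n x) - q t x| <= e.
  move=> e0; have [Ta Ta0 HTa] := hA3a1 e e0; have [Tb Tb0 HTb] := hA3b1 e e0.
  pose T := Num.max Ta Tb; have TaT : Ta <= T by rewrite le_max lexx.
  (* (A3)(b) gives a threshold depending on the time; it is used at the single time [T], and
     monotonicity carries the bound to all later times. *)
  have [N1 HN1] : exists N, forall n, (N <= n)%N -> forall x, V n x ->
     beta n * qG (V n) (mu n) (flr (gamma n * T)) rho x <= e.
   by apply: HTb; rewrite le_max lexx orbT.
  have [N2 HN2] := cvg_pinfty_eventually hbeta 1.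
  exists T, (maxn N1 N2); split; first exact: lt_le_trans TaT.
  move=> n; rewrite geq_max => /andP[/HN1 h1 /HN2 b1] x Fx t Tt.
  have b0 : 0 < beta n by exact: lt_le_trans b1.
  have : Q n t (g n x) <= e.
    rewrite /Q -ler_pdivlMl//.
    apply: (qG_le_mono (hG n) (m := flr (gamma n * T))) => //.
      by apply: le_truncn; rewrite ler_wpM2l.
    by move=> y Vy; rewrite ler_pdivlMl// h1.
  have : 0 <= Q n t (g n x) by rewrite mulr_ge0 ?qG_ge0.
  have : q t x <= e by apply: HTa => //; exact: le_trans Tt.
  have : 0 <= q t x by apply: hq_ge0 => //; apply: lt_le_trans Tt; exact: lt_le_trans TaT.
  by move=> *; rewrite ler_norml; apply/andP; split; lra.

(* Combination of the three regimes *)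
apply: ereal_sup_cvg0.
  move=> n; exists (`|Q n T1 (g n rho) - q T1 rho|)%:E; last by rewrite lee_fin.
  by exists rho, T1.
move=> e e0.
have [T [N1 [T0 H1]]] := late e e0.
have T1T : T1 <= Num.max T1 T by rewrite le_max lexx.
have [r [N2 [r0 H2]]] := far T1 (Num.max T1 T) e hT1 T1T e0.
(* Compactness of the closed ball in [F] makes the local estimate, taken with [e / 7], uniform on
   the bounded region. *)
have [N3 H3] : exists N, forall n, (N <= n)%N -> forall x, (F `&` dcball dE rho r) x ->
    forall t, T1 <= t <= Num.max T1 T -> `|Q n t (g n x) - q t x| <= e.
  apply: (dcompact_eventually hdE (hFcomp rho r r0)) => x0 [Fx0 _].
  have e7 : 0 < e / 7 by rewrite divr_gt0.
  have [s [N [s0 H]]] := local T1 (Num.max T1 T) (e / 7) x0 hT1 T1T e7 Fx0.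
  exists s, N; split=> // n Nn y [Fy _] xy t tT.
  by have := H n Nn y Fy xy t tT; rewrite mulrCA divff ?mulr1.
exists (maxn N1 (maxn N2 N3)) => n; rewrite !geq_max => /and3P[n1 n2 n3] _ [x [t [Fx Tt ->]]].
rewrite lee_fin -/(Q n t (g n x)).
have [tT|tT] := leP T t; first exact: H1.
have tT' : T1 <= t <= Num.max T1 T by rewrite Tt le_max (ltW tT) orbT.
have [xr|xr] := leP r (dE rho x); first exact: H2.
by apply: H3 => //; split=> //; exact: ltW.
Qed.
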